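(* Let $P$ be a fixed $m$-subspace of $R^n$ and let ${\cal M}_R(m_1,m,n)$ be the set of all $m_1$-subspaces of $R^n$ contained in $P$. Then ${\cal M}_R(m_1,m,n)$ is non-empty if and only if $0\leq m_1\leq m\leq n$. Moreover, if it is non-empty, its size $N_R(m_1,m,n)$ does not depend on the choice of $P$ and $$N_R(m_1,m,n)=N_R(m_1,m)=\prod_{j=1}^{\ell}\prod_{i=0}^{m_1-1}\frac{|R_j|^{m-i}-|M_j|^{m-i}}{|R_j|^{m_1-i}-|M_j|^{m_1-i}},$$ where $N_R(m_1,m)$ is the number of $m_1$-subspaces of $R^m$.
   Context: $R$ is a finite commutative ring with identity $1\neq 0$, written as a direct product $R=R_1\times\cdots\times R_\ell$ of finite local rings $R_j$ with maximal ideals $M_j$. $R^n$ denotes the free module of row vectors of length $n$ over $R$. A set $\{\alpha_1,\dots,\alpha_m\}\subseteq R^n$ is unimodular if the $m\times n$ matrix with rows $\alpha_1,\dots,\alpha_m$ has a right inverse in $R^{n\times m}$. An $m$-subspace of $R^n$ is an $R$-submodule of $R^n$ having a basis of $m$ vectors which form a unimodular set; the $0$-subspace is $\{0\}$. *)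

(* Defs.v *)
From HB Require Import structures.
From mathcomp Require Export all_boot all_order all_algebra.
From mathcomp Require Export ring_quotient.

Set Implicit Arguments.
Unset Strict Implicit.
Unset Printing Implicit Defensive.

Import GRing.Theory.
Local Open Scope ring_scope.

(* [idealr_closed] includes 1 \notin I, so I ranges over proper ideals only. *)
Definition maximal_ideal (S : finComNzRingType) (M : {set S}) : Prop :=
  idealr_closed M /\
  forall I : {set S}, idealr_closed I -> M \subset I -> I = M.

Definition local_ring (S : finComNzRingType) (M : {set S}) : Prop :=
  maximal_ideal M /\ forall I : {set S}, maximal_ideal I -> I = M.

(* The ring morphism x |-> (pi 0 x, ..., pi (l-1) x) from R to the direct
   product of the S j is bijective. *)
Definition direct_product (l : nat) (R : finComNzRingType)
    (S : 'I_l -> finComNzRingType) (pi : forall j, {rmorphism R -> S j}) : Prop :=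
  forall y : (forall j, S j), exists! x : R, forall j, pi j x = y j.

Section Subspaces.

Variable R : finComNzRingType.

Definition unimodular (m n : nat) (A : 'M[R]_(m, n)) : bool :=
  [exists B : 'M[R]_(n, m), A *m B == 1%:M].

(* Boolean counterpart of [submod_closed], available since R is finite. *)
Definition submodule (n : nat) (V : {set 'rV[R]_n}) : bool :=
  (0 \in V) &&
  [forall a : R, forall u in V, forall v in V, a *: u + v \in V].

(* The rows of A are linearly independent and generate V;
   x *m A is the linear combination of the rows of A with coefficients x. *)
Definition is_basis (m n : nat) (A : 'M[R]_(m, n)) (V : {set 'rV[R]_n}) : bool :=
  [forall x : 'rV[R]_m, (x *m A == 0) ==> (x == 0)] &&
  (V == [set x *m A | x : 'rV[R]_m]).

(* For m = 0 this holds exactly when V = {0}. *)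
Definition subspace (m n : nat) (V : {set 'rV[R]_n}) : bool :=
  submodule V && [exists A : 'M[R]_(m, n), is_basis A V && unimodular A].

Definition subspaces_in (m1 n : nat) (P : {set 'rV[R]_n}) :
    {set {set 'rV[R]_n}} :=
  [set Q : {set 'rV[R]_n} | subspace m1 Q & Q \subset P].

Definition num_subspaces (m1 m : nat) : nat :=
  #|[set Q : {set 'rV[R]_m} | subspace m1 Q]|.

End Subspaces.

(* Main.v *)
Require Import Defs.
From mathcomp Require Import all_boot all_order all_algebra.
From mathcomp Require Import perm.
Import GRing.Theory Num.Theory.
Local Open Scope ring_scope.

Set Implicit Arguments.
Unset Strict Implicit.
Unset Printing Implicit Defensive.

(** An [m]-subspace is the row span of a unimodular matrix, unique up to left
    multiplication by a unimodular square matrix, which acts freely.  Hence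
    [N_R(m1, m) * U_R(m1, m1) = U_R(m1, m)], where [U_R(m, n)] counts the
    unimodular [m x n] matrices.  [U] is multiplicative over direct products, and
    over a local ring [(S, M)] the first row of a unimodular matrix is any row
    outside [M^n]; a change of basis turns it into [(1, 0, ..., 0)], so that
    [U_S(m+1, n+1) = (|S|^(n+1) - |M|^(n+1)) |S|^m U_S(m, n)].  Subspaces of
    [P] correspond to those of [R^m] through a unimodular basis matrix of [P]. *)

(** * Unimodular matrices and the subspaces they span *)

Section Unimodular.

Variable R : finComNzRingType.

Definition rowspan m n (A : 'M[R]_(m, n)) : {set 'rV[R]_n} :=
  [set x *m A | x : 'rV[R]_m].

Definition unimodular_mxs m n : {set 'M[R]_(m, n)} :=
  [set A | unimodular A].

Lemma unimodularP m n (A : 'M[R]_(m, n)) :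
  reflect (exists B : 'M[R]_(n, m), A *m B = 1%:M) (unimodular A).
Proof.
by apply: (iffP existsP) => -[B /eqP AB]; exists B => //; apply/eqP.
Qed.

Lemma unimodular_mulmx m n p (A : 'M[R]_(m, n)) (B : 'M[R]_(n, p)) :
  unimodular A -> unimodular B -> unimodular (A *m B).
Proof.
move=> /unimodularP[C AC] /unimodularP[D BD]; apply/unimodularP.
by exists (D *m C); rewrite -mulmxA (mulmxA B) BD mul1mx.
Qed.

Lemma unimodular_mulmx_left m n p (A : 'M[R]_(m, n)) (B : 'M[R]_(n, p)) :
  unimodular (A *m B) -> unimodular A.
Proof.
by move=> /unimodularP[C ABC]; apply/unimodularP; exists (B *m C); rewrite mulmxA.
Qed.

Lemma unimodular_mulmxI m n p (A : 'M[R]_(m, n)) :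
  unimodular A -> injective (fun B : 'M[R]_(p, m) => B *m A).
Proof.
move=> /unimodularP[C AC] B B' /(congr1 (mulmx^~ C)).
by rewrite -!mulmxA AC !mulmx1.
Qed.

Lemma mulmx_rowspan m n (A : 'M[R]_(m, n)) (x : 'rV_m) : x *m A \in rowspan A.
Proof. exact: imset_f. Qed.

Lemma rowspan_mulmx m n p (A : 'M[R]_(m, n)) (B : 'M[R]_(n, p)) :
  rowspan (A *m B) = (fun x => x *m B) @: rowspan A.
Proof.
apply/setP=> y; apply/imsetP/imsetP=> [[x _ ->]|[_ /imsetP[x _ ->] ->]].
  by exists (x *m A); rewrite ?mulmxA ?mulmx_rowspan.
by exists x; rewrite ?mulmxA.
Qed.

Lemma rowspan_subP m p n (A : 'M[R]_(m, n)) (B : 'M[R]_(p, n)) :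
  reflect (exists C, A = C *m B) (rowspan A \subset rowspan B).
Proof.
apply: (iffP idP) => [sAB|[C ->]]; last first.
  by apply/subsetP=> _ /imsetP[x _ ->]; rewrite mulmxA mulmx_rowspan.
have rowA i : exists x, row i A = x *m B.
  have: row i A \in rowspan A by rewrite rowE mulmx_rowspan.
  by move/(subsetP sAB)/imsetP => [x _ ->]; exists x.
have [f fE] := fin_all_exists rowA.
exists (\matrix_i f i); apply/row_matrixP=> i.
by rewrite row_mul rowK.
Qed.

Lemma subspaceP m n (V : {set 'rV[R]_n}) :
  reflect (exists2 A : 'M[R]_(m, n), unimodular A & V = rowspan A)
          (subspace m V).
Proof.
apply: (iffP andP) => [[_ /existsP[A /andP[/andP[_ /eqP VA] uA]]]|[A uA ->]].
  by exists A.
split.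
  apply/andP; split; first by rewrite -(mul0mx _ A) mulmx_rowspan.
  apply/forallP=> a; apply/forall_inP=> _ /imsetP[x _ ->].
  apply/forall_inP=> _ /imsetP[y _ ->].
  by rewrite scalemxAl -mulmxDl mulmx_rowspan.
apply/existsP; exists A; rewrite uA andbT /is_basis eqxx andbT.
apply/forallP=> x; apply/implyP=> /eqP xA; apply/eqP.
by apply: (unimodular_mulmxI uA); rewrite xA mul0mx.
Qed.

(** By counting: [x *m A] is injective in [x], so |R|^m <= |R|^n, and |R| >= 2 because 0 and 1
    differ. *)
Lemma unimodular_leq m n (A : 'M[R]_(m, n)) : unimodular A -> (m <= n)%N.
Proof.
move=> uA; have := leq_card _ (@unimodular_mulmxI _ _ 1 _ uA).
rewrite !card_mx !mul1n leq_exp2l //.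
by rewrite (cardD1 0) (cardD1 1) !inE oner_neq0.
Qed.

Lemma unimodular_pid m n : (m <= n)%N -> unimodular (pid_mx m : 'M[R]_(m, n)).
Proof.
by move=> lemn; apply/unimodularP; exists (pid_mx m); rewrite pid_mx_id // pid_mx_1.
Qed.

(** The top block row of the product forces the upper right block of a right inverse to vanish, so
    its lower right block inverts [A]. Conversely, [a] is cleared by block elimination. *)
Lemma unimodular_block m n p (a : 'M[R]_(m, p)) (A : 'M[R]_(m, n)) :
  unimodular (block_mx 1%:M 0 a A) = unimodular A.
Proof.
apply/unimodularP/unimodularP=> [[B]|[D AD]].
  rewrite -[B]submxK mulmx_block scalar_mx_block !mul1mx !mul0mx !addr0.
  case/eq_block_mx=> _ -> _; rewrite mulmx0 add0r => AB.
  by exists (drsubmx B).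
exists (block_mx 1%:M 0 (- (D *m a)) D).
rewrite mulmx_block scalar_mx_block !mul1mx !mul0mx !mulmx0 !mulmx1 !addr0 add0r.
by rewrite mulmxN mulmxA AD mul1mx subrr.
Qed.

Lemma unimodular_usubmx m p n (A : 'M[R]_(m, n)) (B : 'M[R]_(p, n)) :
  unimodular (col_mx A B) -> unimodular A.
Proof.
move=> /unimodularP[C]; rewrite -[C]hsubmxK mul_col_row scalar_mx_block.
by case/eq_block_mx=> AC _ _ _; apply/unimodularP; exists (lsubmx C).
Qed.

(** The fibre over the span of [A] is the injective image of the square unimodular matrices under
    [G *m A]. Over a commutative ring a one-sided inverse of [G] is two-sided, which gives equality
    of the spans. *)
Lemma card_unimodular_rowspan m n (A : 'M[R]_(m, n)) : unimodular A ->
  #|[set B in unimodular_mxs m n | rowspan B == rowspan A]|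
    = #|unimodular_mxs m m|.
Proof.
move=> uA; rewrite -(card_imset (mem (unimodular_mxs m m)) (unimodular_mulmxI uA)).
apply: eq_card => B; rewrite !inE; apply/andP/imsetP=> [[uB /eqP BA]|[G]].
  have /rowspan_subP[G BG]: rowspan B \subset rowspan A by rewrite BA.
  by exists G => //; rewrite inE; move: uB; rewrite BG; apply: unimodular_mulmx_left.
rewrite inE => uG ->; split; first exact: unimodular_mulmx.
have /unimodularP[H /mulmx1C HG] := uG.
rewrite eqEsubset; apply/andP; split; apply/rowspan_subP; first by exists G.
by exists H; rewrite mulmxA HG mul1mx.
Qed.

Lemma num_subspaces_mul m n :
  (num_subspaces R m n * #|unimodular_mxs m m| = #|unimodular_mxs m n|)%N.
Proof.
(* Double counting: unimodular matrices are sorted by their row span, and all fibres have the same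
   size. *)
rewrite -[RHS]sum1_card (partition_big_imset (@rowspan m n)) /=.
have -> : [set rowspan A | A in unimodular_mxs m n]
          = [set Q : {set 'rV[R]_n} | subspace m Q].
  apply/setP=> Q; rewrite inE; apply/imsetP/subspaceP => -[A uA ->]; exists A => //.
    by rewrite inE in uA.
  by rewrite inE.
rewrite /num_subspaces -sum_nat_const; apply: eq_bigr => Q.
rewrite inE => /subspaceP[A uA ->].
by rewrite -(card_unimodular_rowspan uA) -sum1dep_card.
Qed.

(** Right multiplication by a basis matrix of [P] embeds R^m onto [P]; [C] is unimodular exactly
    when [C *m A] is, so subspaces correspond. *)
Lemma card_subspaces_in m1 m n (P : {set 'rV[R]_n}) :
  subspace m P -> #|subspaces_in m1 P| = num_subspaces R m1 m.
Proof.
case/subspaceP=> A uA ->; pose f (x : 'rV[R]_m) := x *m A.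
have f_inj : injective f := unimodular_mulmxI uA.
rewrite /num_subspaces -(card_imset _ (imset_inj f_inj)).
apply: eq_card => Q; rewrite inE; apply/andP/imsetP => [[]|[Q']].
  case/subspaceP=> B uB -> /rowspan_subP[C BC].
  exists (rowspan C); last by rewrite BC rowspan_mulmx.
  rewrite inE; apply/subspaceP; exists C => //.
  by move: uB; rewrite BC; apply: unimodular_mulmx_left.
rewrite inE => /subspaceP[C uC ->] ->; rewrite -rowspan_mulmx; split.
  by apply/subspaceP; exists (C *m A) => //; apply: unimodular_mulmx.
by apply/rowspan_subP; exists C.
Qed.

Lemma subspaces_in_neq0 m1 m n (P : {set 'rV[R]_n}) : subspace m P ->
  (subspaces_in m1 P != set0) = (m1 <= m)%N.
Proof.
move=> sP; rewrite -card_gt0 (card_subspaces_in _ sP) card_gt0.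
apply/set0Pn/idP => [[Q]|le_m1m].
  by rewrite inE => /subspaceP[A uA _]; apply: unimodular_leq uA.
exists (rowspan (pid_mx m1 : 'M[R]_(m1, m))); rewrite inE; apply/subspaceP.
by exists (pid_mx m1) => //; apply: unimodular_pid.
Qed.

End Unimodular.

(** * Reduction to the factors of a direct product *)

Section DirectProduct.

Variables (l : nat) (R : finComNzRingType) (S : 'I_l -> finComNzRingType).
Variable pi : forall j, {rmorphism R -> S j}.
Hypothesis R_prod : direct_product pi.

Lemma direct_product_mx_inj m n (A B : 'M[R]_(m, n)) :
  (forall j, map_mx (pi j) A = map_mx (pi j) B) -> A = B.
Proof.
move=> eqAB; apply/matrixP=> i k.
have [x [_ x_uniq]] := R_prod (fun j => pi j (A i k)).
rewrite -(x_uniq (A i k)) // -(x_uniq (B i k)) // => j.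
by have /matrixP/(_ i k) := eqAB j; rewrite !mxE.
Qed.

Lemma direct_product_mx_surj m n (B : forall j, 'M[S j]_(m, n)) :
  exists A : 'M[R]_(m, n), forall j, map_mx (pi j) A = B j.
Proof.
have ex_entry (ik : 'I_m * 'I_n) : exists x, forall j, pi j x = B j ik.1 ik.2.
  by have [x [xE _]] := R_prod (fun j => B j ik.1 ik.2); exists x.
have [f fE] := fin_all_exists ex_entry.
exists (\matrix_(i, k) f (i, k)) => j; apply/matrixP=> i k.
by rewrite !mxE fE.
Qed.

Lemma unimodular_direct_product m n (A : 'M[R]_(m, n)) :
  unimodular A = [forall j, unimodular (map_mx (pi j) A)].
Proof.
apply/unimodularP/forallP=> [[B AB] j|uA].
  by apply/unimodularP; exists (map_mx (pi j) B); rewrite -map_mxM AB map_mx1.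
have ex_inv j : exists B, map_mx (pi j) A *m B = 1%:M by apply/unimodularP.
(* The right inverses chosen over the factors are glued into one over [R]; the identity is then
   checked factor by factor. *)
have [B' B'E] := fin_all_exists ex_inv.
have [B BE] := direct_product_mx_surj B'.
by exists B; apply: direct_product_mx_inj => j; rewrite map_mxM BE B'E map_mx1.
Qed.

Lemma card_unimodular_direct_product m n :
  #|unimodular_mxs R m n| = (\prod_(j < l) #|unimodular_mxs (S j) m n|)%N.
Proof.
pose f (A : 'M[R]_(m, n)) : {dffun forall j, 'M[S j]_(m, n)} :=
  [ffun j => map_mx (pi j) A].
have f_inj : injective f.
  move=> A B /ffunP eqAB; apply: direct_product_mx_inj => j.
  by have := eqAB j; rewrite !ffunE.
rewrite -cardsXn -(card_imset _ f_inj); apply: eq_card => g.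
rewrite in_setXn; apply/imsetP/forallP=> [[A uA ->] j|ug].
  by move: uA; rewrite !inE ffunE unimodular_direct_product => /forallP.
have [A AE] := direct_product_mx_surj g.
exists A; last by apply/ffunP=> j; rewrite ffunE AE.
rewrite inE unimodular_direct_product; apply/forallP=> j.
by have := ug j; rewrite inE AE.
Qed.

End DirectProduct.

(** * Counting unimodular matrices over a local ring *)

Section LocalRing.

Variables (S : finComNzRingType) (M : {set S}).
Hypothesis S_local : local_ring M.

Lemma local_ideal : idealr_closed M.
Proof. by case: S_local => -[]. Qed.

(** If [x] had no inverse, the ideal generated by [x] would be proper, hence inside a maximal ideal,
    which can only be [M]. *)
Lemma local_unit x : x \notin M -> exists y, x * y = 1.
Proof.
move=> xM.
have [/existsP[y /eqP xy]|no_inv] := boolP [exists y, x * y == 1]; first by exists y.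
(* A boolean form of [idealr_closed], so that [maxset_exists] can supply a maximal ideal. *)
pose idealb (I : {set S}) := [&& 0 \in I, 1 \notin I &
  [forall a, forall u in I, forall v in I, a * u + v \in I]].
have idealP (I : {set S}) : reflect (idealr_closed I) (idealb I).
  apply: (iffP and3P) => -[I0 I1 Iclosed]; split=> //.
    move=> a u v uI vI.
    by move/forallP/(_ a)/forall_inP/(_ u uI)/forall_inP: Iclosed; apply.
  apply/forallP=> a; apply/forall_inP=> u uI; apply/forall_inP=> v vI.
  exact: Iclosed.
have xS_ideal : idealb [set x * y | y : S].
  apply/idealP; split.
  - by apply/imsetP; exists 0; rewrite ?mulr0.
  - apply: contra no_inv => /imsetP[y _ xy].
    by apply/existsP; exists y; rewrite -xy.
  - move=> a _ _ /imsetP[u _ ->] /imsetP[v _ ->].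
    by apply/imsetP; exists (a * u + v); rewrite // mulrDr mulrCA.
have [I /maxsetP[Iideal Imax] xI] := maxset_exists xS_ideal.
have IM : I = M.
  case: S_local => _; apply; split; first exact/idealP.
  by move=> J /idealP Jideal IJ; apply: Imax.
case/negP: xM; rewrite -IM; apply: (subsetP xI).
by apply/imsetP; exists 1; rewrite ?mulr1.
Qed.

Lemma unimodular_row_localP n (u : 'rV[S]_n) :
  reflect (exists k, u 0 k \notin M) (unimodular u).
Proof.
have [M0 M1 Mclosed] := local_ideal.
apply: (iffP idP) => [/unimodularP[B uB]|[k /local_unit[y uky]]].
  (* If every entry lay in [M], then so would 1, a combination of the entries. *)
  apply/existsP; apply: contraR M1; rewrite negb_exists => /forallP uM.
  have -> : 1 = \sum_k u 0 k * B k 0.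
    by have /matrixP/(_ 0 0) := uB; rewrite !mxE eqxx mulr1n => <-.
  apply: (big_ind (fun x => x \in M)) => // [x z xM zM|k _].
    by rewrite -[x]mul1r Mclosed.
  by rewrite mulrC -[_ * _]addr0 Mclosed //; have := uM k; rewrite negbK.
apply/unimodularP; exists (y *: delta_mx k 0).
rewrite -scalemxAr -colE; apply/matrixP=> i j.
by rewrite !ord1 !mxE mulrC uky eqxx.
Qed.

Lemma card_unimodular_row n :
  #|unimodular_mxs S 1 n| = (#|S| ^ n - #|M| ^ n)%N.
Proof.
pose f (u : {ffun 'I_n -> S}) : 'rV[S]_n := \row_k u k.
have f_inj : injective f.
  by move=> u v /rowP eq_uv; apply/ffunP=> k; have := eq_uv k; rewrite !mxE.
have -> : unimodular_mxs S 1 n = ~: (f @: ffun_on (mem M)).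
  apply/setP=> u; rewrite !inE; apply/unimodular_row_localP/idP => [[k ukM]|].
    apply: contra ukM => /imsetP[v /ffun_onP vM ->].
    by rewrite mxE; apply: vM.
  move=> uNM; apply/existsP; apply: contraR uNM; rewrite negb_exists => /forallP uM.
  apply/imsetP; exists [ffun k => u 0 k].
    by apply/ffun_onP=> k; rewrite ffunE; have := uM k; rewrite negbK.
  by apply/rowP=> k; rewrite mxE ffunE.
by rewrite cardsCs setCK card_mx mul1n card_imset // card_ffun_on card_ord.
Qed.

(** Column operations: a unit entry is swapped to the front, scaled to 1 and used to clear the
    others. The inverse [H] has [u] as its first row. *)
Lemma unimodular_row_complete n (u : 'rV[S]_n.+1) : unimodular u ->
  exists G H : 'M[S]_(1 + n),
    [/\ G *m H = 1%:M, H *m G = 1%:M & u *m G = row_mx (1%:M : 'M_1) 0].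
Proof.
case/unimodular_row_localP=> k /local_unit[y uky].
pose T : 'M[S]_(1 + n) := tperm_mx k 0.
have TT : T *m T = 1%:M by rewrite -perm_mxM tperm2 perm_mx1.
pose v : 'rV[S]_(1 + n) := u *m T; pose w := rsubmx v.
have vE : v = row_mx (u 0 k)%:M w.
  rewrite -[v]hsubmxK; congr row_mx; apply/matrixP=> i j.
  rewrite !ord1 /v /T -xcolE !mxE eqxx mulr1n.
  by congr (u _ _); rewrite (_ : lshift n (0 : 'I_1) = (0 : 'I_n.+1)) ?tpermR //; apply: val_inj.
pose G := T *m block_mx (y%:M : 'M_1) (- (y *: w)) 0 1%:M.
pose H := block_mx ((u 0 k)%:M : 'M_1) w 0 1%:M *m T.
have HG : H *m G = 1%:M.
  rewrite /H /G -mulmxA (mulmxA T) TT mul1mx mulmx_block [RHS]scalar_mx_block.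
  rewrite !mul0mx !mulmx0 !mul1mx !mulmx1 !addr0 !add0r -scalar_mxM uky.
  by rewrite mulmxN mul_scalar_mx scalerA uky scale1r addNr.
exists G, H; split=> //; first exact: mulmx1C.
rewrite /G mulmxA -/v vE mul_row_block mulmx0 addr0 mulmx1 -scalar_mxM uky.
by rewrite mulmxN mul_scalar_mx scalerA uky scale1r addNr.
Qed.

(** After right multiplication by the invertible [G] the first row is (1, 0, ..., 0). The column
    below the 1 is then arbitrary, giving |S|^m choices, and the remaining block must be
    unimodular. *)
Lemma card_unimodular_col_mx m n (u : 'rV[S]_n.+1) : unimodular u ->
  #|[set A : 'M[S]_(m, n.+1) | unimodular (col_mx u A)]|
    = (#|S| ^ m * #|unimodular_mxs S m n|)%N.
Proof.
move=> /unimodular_row_complete[G [H [GH HG uG]]].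
pose f (aA : 'cV[S]_m * 'M[S]_(m, n)) : 'M[S]_(m, 1 + n) :=
  row_mx aA.1 aA.2 *m H.
have f_inj : injective f.
  move=> [a A] [b B] /(congr1 (mulmx^~ G)).
  by rewrite -!mulmxA HG !mulmx1 /= => /eq_row_mx[-> ->].
have -> : (#|S| ^ m)%N = #|[set: 'cV[S]_m]| by rewrite cardsT card_mx muln1.
have uGE (B : 'M[S]_(1 + m, 1 + n)) : unimodular (B *m G) = unimodular B.
  apply/idP/idP; first exact: unimodular_mulmx_left.
  by move/unimodular_mulmx; apply; apply/unimodularP; exists H.
rewrite -cardsX -(card_imset _ f_inj); apply: eq_card => A.
rewrite inE -uGE mul_col_mx uG; apply/idP/imsetP=> [uAG|[[a B] aB ->]].
  exists (lsubmx (A *m G : 'M_(m, 1 + n)), rsubmx (A *m G : 'M_(m, 1 + n))).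
    rewrite !inE /=; move: uAG.
    rewrite -[X in col_mx _ X](hsubmxK (A *m G : 'M_(m, 1 + n))).
    by rewrite -block_mxEv unimodular_block.
  by rewrite /f hsubmxK -mulmxA GH mulmx1.
rewrite /f -mulmxA HG mulmx1 /= -block_mxEv unimodular_block.
by move: aB; rewrite !inE.
Qed.

Lemma card_unimodularS m n :
  #|unimodular_mxs S m.+1 n.+1|
    = ((#|S| ^ n.+1 - #|M| ^ n.+1) * (#|S| ^ m * #|unimodular_mxs S m n|))%N.
Proof.
rewrite -card_unimodular_row -[LHS]sum1_card.
(* The matrices are sorted by their first row, itself unimodular; the number of completions is the
   same for each. *)
rewrite (partition_big (fun A : 'M[S]_(1 + m, n.+1) => usubmx A)
           (mem (unimodular_mxs S 1 n.+1))) /=; last first.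
  move=> A; rewrite !inE => uA.
  by apply: (@unimodular_usubmx _ 1 m _ _ (dsubmx A)); rewrite vsubmxK.
rewrite -sum_nat_const; apply: eq_bigr => u; rewrite inE => uu.
rewrite -(card_unimodular_col_mx m uu) sum1dep_card.
pose f (A : 'M[S]_(m, n.+1)) : 'M[S]_(1 + m, n.+1) := col_mx u A.
have f_inj : injective f by move=> A B /eq_col_mx[].
rewrite -[RHS](card_imset _ f_inj); apply: eq_card => A.
rewrite inE; apply/andP/imsetP=> [[uA /eqP Au]|[B uB ->]].
  by exists (dsubmx (A : 'M_(1 + m, n.+1))); rewrite ?inE /f -Au vsubmxK // inE in uA *.
by move: uB; rewrite !inE col_mxKu eqxx.
Qed.

Lemma card_unimodular_local m n : (m <= n)%N ->
  #|unimodular_mxs S m n|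
    = (\prod_(i < m) ((#|S| ^ (n - i) - #|M| ^ (n - i)) * #|S| ^ (m - i.+1)))%N.
Proof.
elim: m n => [|m IHm] n lemn.
  (* The only matrix without rows is unimodular, matching the empty product. *)
  rewrite big_ord0; apply/eqP/cards1P; exists 0.
  apply/setP=> A; rewrite !inE [A]flatmx0 eqxx.
  by apply/unimodularP; exists 0; rewrite [LHS]flatmx0 [RHS]flatmx0.
case: n lemn => // n lemn.
rewrite card_unimodularS IHm // big_ord_recl /= !subn0 subn1 mulnA.
by congr muln; apply: eq_bigr => i _; rewrite !subSS.
Qed.

Lemma card_local_lt k : (0 < k)%N -> (#|M| ^ k < #|S| ^ k)%N.
Proof.
move=> k_gt0; have [_ M1 _] := local_ideal.
rewrite ltn_exp2r // -(cardsT S).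
apply: proper_card; rewrite properT; apply: contraNneq M1 => ->.
exact: in_setT.
Qed.

(** The factors |S|^(m1 - i - 1) depend only on the number of rows, so they cancel in the
    quotient. *)
Lemma card_unimodular_ratio m1 m : (m1 <= m)%N ->
  #|unimodular_mxs S m1 m|%:R / #|unimodular_mxs S m1 m1|%:R
  = \prod_(i < m1)
      (((#|S| ^ (m - i))%N%:R - (#|M| ^ (m - i))%N%:R) /
       ((#|S| ^ (m1 - i))%N%:R - (#|M| ^ (m1 - i))%N%:R)) :> rat.
Proof.
move=> le_m1m; rewrite !card_unimodular_local // !natr_prod -prodf_div.
apply: eq_bigr => i _; have lt_im := leq_trans (ltn_ord i) le_m1m.
(* The truncated differences become rational ones because |M|^k <= |S|^k. *)
rewrite !natrM !natrB; try by apply/ltnW/card_local_lt; rewrite subn_gt0.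
rewrite -mulf_div divff ?mulr1 // pnatr_eq0 -lt0n expn_gt0.
by apply/orP; left; apply/card_gt0P; exists 0.
Qed.

End LocalRing.

Theorem theorem4p2 (l : nat) (R : finComNzRingType)
    (S : 'I_l -> finComNzRingType) (M : forall j : 'I_l, {set (S j)})
    (pi : forall j : 'I_l, {rmorphism R -> S j})
    (R_prod : direct_product pi)
    (S_local : forall j : 'I_l, local_ring (M j))
    (m1 m n : nat) (P : {set 'rV[R]_n}) (P_sub : subspace m P) :
  (subspaces_in m1 P != set0 <-> [/\ (0 <= m1)%N, (m1 <= m)%N & (m <= n)%N]) /\
  (subspaces_in m1 P != set0 ->
    [/\ forall P' : {set 'rV[R]_n}, subspace m P' ->
          #|subspaces_in m1 P'| = #|subspaces_in m1 P|,
        #|subspaces_in m1 P| = num_subspaces R m1 m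
      & (num_subspaces R m1 m)%:R =
          \prod_(j < l) \prod_(i < m1)
            (((#|S j| ^ (m - i))%N%:R - (#|M j| ^ (m - i))%N%:R) /
             ((#|S j| ^ (m1 - i))%N%:R - (#|M j| ^ (m1 - i))%N%:R)) :> rat]).
Proof.
rewrite (subspaces_in_neq0 _ P_sub); split.
  split=> [le_m1m|[]//]; split=> //.
  by case/subspaceP: P_sub => A /unimodular_leq.
move=> le_m1m; split=> [P' P'_sub||].
- by rewrite !(card_subspaces_in _ (m := m)).
- exact: card_subspaces_in.
(* The identity matrix is unimodular, so one may divide by this count and compare the quotient of
   the two counts over [R] with the product of the local quotients. *)
have U_neq0 : (#|unimodular_mxs R m1 m1|%:R : rat) != 0.
  rewrite pnatr_eq0 -lt0n; apply/card_gt0P; exists 1%:M.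
  by rewrite inE; apply/unimodularP; exists 1%:M; rewrite mulmx1.
apply: (mulIf U_neq0); rewrite -natrM num_subspaces_mul.
apply/eqP; rewrite -(divfK U_neq0 _%:R) (inj_eq (mulIf U_neq0)); apply/eqP.
rewrite !(card_unimodular_direct_product R_prod) !natr_prod -prodf_div.
by apply: eq_bigr => j _; apply: card_unimodular_ratio.
Qed.
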